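(* Let $(L,\theta)=(L,\cdot)$ be a C-loop and let $(A,B,C)\in Aut(L,\cdot)$. For each $x\in L$ put $(S_1,T_1,\mathcal{R}_1)=(A,B,C)(L_x^2,I,L_x^2)$ and $(S_2,T_2,\mathcal{R}_2)=(A,B,C)(I,R_x^2,R_x^2)$ (autotopisms of $L$ depending on $x$), and $\alpha_i=S_i^{-1}$, $\beta_i=T_i^{-1}$, $\gamma_i=\mathcal{R}_i^{-1}$ for $i=1,2$. Then the two parastrophes $(L,\theta^{-1})$ and $(L,{}^{-1}\theta)$ are both equal to $(L,\theta)$ if and only if, for every $x\in L$, the first component $\alpha_1S_2$ of the autotopism $(\alpha_1S_2,\beta_1T_2,\gamma_1\mathcal{R}_2)$ and the second component $\beta_2T_1$ of the autotopism $(\alpha_2S_1,\beta_2T_1,\gamma_2\mathcal{R}_1)$ are both equal to the identity map. Moreover, in that case the other three parastrophes $(L,\theta^* )$, $(L,(\theta^{-1})^* )$ and $(L,({}^{-1}\theta)^* )$ are also equal to $(L,\theta)$.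
   Context: A loop is a quasigroup with a two-sided identity element. A C-loop is a loop satisfying $x(y(yz))=((xy)y)z$ for all $x,y,z$. Maps are written on the right of their arguments and composed from left to right (so $y(UV)=(yU)V$). The translations $L_x,R_x:L\to L$ are the bijections $yL_x=x\cdot y$ and $yR_x=y\cdot x$; $L_x^2$ and $R_x^2$ denote the composites $L_xL_x$ and $R_xR_x$, and $I$ is the identity map. A triple $(U,V,W)$ of bijections of $L$ is an autotopism of $L$ if $xU\cdot yV=(x\cdot y)W$ for all $x,y\in L$; the autotopisms form a group $Aut(L,\cdot)$ under the componentwise product. The five parastrophes of a quasigroup $(L,\theta)$ are the quasigroups on $L$ with operations $\theta^*,\theta^{-1},{}^{-1}\theta,(\theta^{-1})^*,({}^{-1}\theta)^*$ defined, for all $x,y,z\in L$, by: $y\,\theta^*\,x=z\Leftrightarrow x\,\theta\,y=z$; $x\,\theta^{-1}\,z=y\Leftrightarrow x\,\theta\,y=z$; $z\,{}^{-1}\theta\,y=x\Leftrightarrow x\,\theta\,y=z$; $z\,(\theta^{-1})^*\,x=y\Leftrightarrow x\,\theta\,y=z$; $y\,({}^{-1}\theta)^*\,z=x\Leftrightarrow x\,\theta\,y=z$. Two groupoids are called equivalent (equal) if they have the same underlying set and the same binary operation. *)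

(* Defs.v *)
From HB Require Import structures.
From mathcomp Require Import all_boot.
From mathcomp Require Import boolp.

Set Implicit Arguments.
Unset Strict Implicit.
Unset Printing Implicit Defensive.

Local Open Scope group_scope.

Record bij (L : Type) := Bij { bij_fun :> L -> L; bij_bijective : bijective bij_fun }.

Lemma bijP (L : Type) (U V : bij L) : U =1 V -> U = V.
Proof.
case: U V => f fb [g gb] /= /funext fg; case: _ / fg in gb *.
by congr Bij; exact: Prop_irrelevance.
Qed.

Section BijGroup.
Variable L : Type.
Implicit Types U V W : bij L.

Definition bij_one : bij L := @Bij L id (Bijective (fun=> erefl) (fun=> erefl)).

(* Maps act on the right, so the product applies U first (as for {perm T}). *)
Definition bij_mul U V : bij L :=
  Bij (bij_comp (bij_bijective V) (bij_bijective U)).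

Lemma bij_inv_exists U : exists g : L -> L, cancel U g /\ cancel g U.
Proof. by case: (bij_bijective U) => g *; exists g. Qed.

Definition bij_inv_fun U : L -> L := projT1 (cid (bij_inv_exists U)).

Lemma bijK U : cancel U (bij_inv_fun U).
Proof. by rewrite /bij_inv_fun; case: cid => g []. Qed.

Lemma bijVK U : cancel (bij_inv_fun U) U.
Proof. by rewrite /bij_inv_fun; case: cid => g []. Qed.

Definition bij_inv U : bij L := Bij (Bijective (bijVK U) (bijK U)).

Lemma bij_mulA : associative bij_mul.
Proof. by move=> U V W; apply: bijP. Qed.

Lemma bij_mul1 : left_id bij_one bij_mul.
Proof. by move=> U; apply: bijP. Qed.

Lemma bij_mul1r : right_id bij_one bij_mul.
Proof. by move=> U; apply: bijP. Qed.

Lemma bij_mulV : left_inverse bij_one bij_inv bij_mul.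
Proof. by move=> U; apply: bijP => x /=; rewrite bijVK. Qed.

Lemma bij_mulVr : right_inverse bij_one bij_inv bij_mul.
Proof. by move=> U; apply: bijP => x /=; rewrite bijK. Qed.

HB.instance Definition _ := gen_eqMixin (bij L).
HB.instance Definition _ := gen_choiceMixin (bij L).
HB.instance Definition _ :=
  isGroup.Build (bij L) bij_mulA bij_mul1 bij_mul1r bij_mulV bij_mulVr.

Lemma bij1E x : (1 : bij L) x = x. Proof. by []. Qed.
Lemma bijME U V x : (U * V) x = V (U x). Proof. by []. Qed.
Lemma bijVKE U x : U (U^-1 x) = x. Proof. exact: bijVK. Qed.
Lemma bijKE U x : U^-1 (U x) = x. Proof. exact: bijK. Qed.

End BijGroup.

Record quasigroup (L : Type) := Quasigroup {
  qop :> L -> L -> L;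
  qop_left : forall x, bijective (fun y => qop x y);
  qop_right : forall x, bijective (fun y => qop y x)
}.

Section Quasigroups.
Variable L : Type.
Implicit Types Q P : quasigroup L.

Definition Ltrans Q x : bij L := Bij (qop_left Q x).
Definition Rtrans Q x : bij L := Bij (qop_right Q x).

Definition is_loop Q := exists e : L, forall x, Q e x = x /\ Q x e = x.

Definition is_C_loop Q :=
  is_loop Q /\ forall x y z, Q x (Q y (Q y z)) = Q (Q (Q x y) y) z.

(* A triple ((U, V), W) is an element of the product group
   bij L * bij L * bij L, whose operations are componentwise. *)
Definition autotopism Q (t : bij L * bij L * bij L) :=
  forall x y, Q (t.1.1 x) (t.1.2 y) = t.2 (Q x y).

Lemma autotopism1 Q : autotopism Q 1.
Proof. by []. Qed.

Lemma autotopismM Q s t : autotopism Q s -> autotopism Q t -> autotopism Q (s * t).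
Proof. by move=> hs ht x y; rewrite [LHS]ht hs. Qed.

Lemma autotopismV Q t : autotopism Q t -> autotopism Q t^-1.
Proof.
move=> ht x y.
by rewrite -[LHS](bijKE t.2) -ht !bijVKE.
Qed.

Definition equal_groupoids P Q := forall x y, P x y = Q x y.

Definition par_star Q : quasigroup L :=
  @Quasigroup L (fun y x => Q x y) (qop_right Q) (qop_left Q).

Lemma par_starP Q x y z : par_star Q y x = z <-> Q x y = z.
Proof. by []. Qed.

Definition ldiv Q x z := (Ltrans Q x)^-1 z.
Definition rdiv Q z y := (Rtrans Q y)^-1 z.

Lemma ldivP Q x y z : ldiv Q x z = y <-> Q x y = z.
Proof.
by split=> <-; [exact: (bijVKE (Ltrans Q x)) | exact: (bijKE (Ltrans Q x))].
Qed.

Lemma rdivP Q x y z : rdiv Q z y = x <-> Q x y = z.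
Proof.
by split=> <-; [exact: (bijVKE (Rtrans Q y)) | exact: (bijKE (Rtrans Q y))].
Qed.

Lemma ldiv_left Q x : bijective (fun z => ldiv Q x z).
Proof. exact: (bij_bijective (Ltrans Q x)^-1). Qed.

Lemma ldiv_right Q z : bijective (fun x => ldiv Q x z).
Proof.
exists (fun y => rdiv Q z y) => [x|y]; first by apply/rdivP/ldivP.
by apply/ldivP/rdivP.
Qed.

Lemma rdiv_left Q z : bijective (fun y => rdiv Q z y).
Proof.
exists (fun x => ldiv Q x z) => [y|x]; first by apply/ldivP/rdivP.
by apply/rdivP/ldivP.
Qed.

Lemma rdiv_right Q y : bijective (fun z => rdiv Q z y).
Proof. exact: (bij_bijective (Rtrans Q y)^-1). Qed.

(* theta^{-1} and {}^{-1}theta; their defining equivalences are par_invrP and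
   par_invlP below. *)
Definition par_invr Q : quasigroup L := Quasigroup (ldiv_left Q) (ldiv_right Q).
Definition par_invl Q : quasigroup L := Quasigroup (rdiv_left Q) (rdiv_right Q).

Lemma par_invrP Q x y z : par_invr Q x z = y <-> Q x y = z.
Proof. exact: ldivP. Qed.

Lemma par_invlP Q x y z : par_invl Q z y = x <-> Q x y = z.
Proof. exact: rdivP. Qed.

Definition par_invr_star Q := par_star (par_invr Q).
Definition par_invl_star Q := par_star (par_invl Q).

Lemma par_invr_starP Q x y z : par_invr_star Q z x = y <-> Q x y = z.
Proof. exact: ldivP. Qed.

Lemma par_invl_starP Q x y z : par_invl_star Q y z = x <-> Q x y = z.
Proof. exact: rdivP. Qed.

End Quasigroups.

(* Main.v *)
Require Import Defs.
From mathcomp Require Import all_boot.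

Set Implicit Arguments.
Unset Strict Implicit.

Local Open Scope group_scope.

(** The arbitrary autotopism [(A, B, C)] cancels: [(A L_x^2)^-1 A] is [L_x^-2]
    and [(B R_x^2)^-1 B] is [R_x^-2].  The condition on components therefore
    says that every translation is an involution ([invgM_eq1]).  That is what
    the equality with the two division parastrophes says as well: the left
    division [x \ z] is [x z] exactly when [x (x z) = z] ([par_invr_eqP]), and
    dually on the right ([par_invl_eqP]).

    The part specific to C-loops is that [(L_x^2, I, L_x^2)] and
    [(I, R_x^2, R_x^2)] are autotopisms, that is, that squares lie in the left
    and right nuclei.  The C-law with [x] or [z] equal to the identity gives
    both alternative laws, so the C-law itself says that squares lie in the
    middle nucleus.  Cancelling in the C-law also gives two-sided inverses with
    the inverse property ([C_loop_IP]), and in an inverse property loop the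
    middle nucleus is contained in the other two ([IP_mid_nucleus_right],
    [IP_mid_nucleus_left]).

    Finally, if both families of translations consist of involutions, then the
    equation [x y = z] is invariant under all permutations of its letters, in
    particular under exchanging [x] and [y] ([involutive_translations_comm]);
    so the opposite operations coincide with the original one too. *)

(** * Inverse property loops and their nuclei *)

Section InverseProperty.
Variables (L : Type) (Q : quasigroup L).

(** A function [J] of this kind makes the inverse of each translation the
    translation by the inverse. *)
Definition inverse_property (J : L -> L) :=
  (forall x y, Q (J x) (Q x y) = y) /\ (forall x y, Q (Q y x) (J x) = y).

Lemma qop_injl x : injective (Q x).
Proof. exact: bij_inj (qop_left Q x). Qed.

Lemma qop_injr y : injective (Q^~ y).
Proof. exact: bij_inj (qop_right Q y). Qed.

Variable J : L -> L.
Hypothesis IP : inverse_property J.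

Lemma IP_mulKl x y : Q (J x) (Q x y) = y. Proof. exact: IP.1. Qed.
Lemma IP_mulKr x y : Q (Q y x) (J x) = y. Proof. exact: IP.2. Qed.

(** Translations of a quasigroup are injective, so the one-sided cancellation
    laws above are two-sided: both sides agree after multiplication by [J x]. *)
Lemma IP_mulVKl x y : Q x (Q (J x) y) = y.
Proof. by apply: (@qop_injl (J x)); rewrite IP_mulKl. Qed.

Lemma IP_mulVKr x y : Q (Q y (J x)) x = y.
Proof. by apply: (@qop_injr (J x)); rewrite IP_mulKr. Qed.

(** Solving [x y = z] for [y], then for [J x], then for [J z]. *)
Lemma IP_invM x y : J (Q x y) = Q (J y) (J x).
Proof.
have yJz : Q y (J (Q x y)) = J x.
  by rewrite -{1}(IP_mulKl x y) IP_mulKr.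
by rewrite -yJz IP_mulKl.
Qed.

(** Inverting the second factor turns [(w n) z = w (n z)], with [w = x y] and
    [z = J (y n)], into the right nuclear law. *)
Lemma IP_mid_nucleus_right n :
    (forall w z, Q (Q w n) z = Q w (Q n z)) ->
  forall x y, Q (Q x y) n = Q x (Q y n).
Proof.
move=> midn x y; apply: (@qop_injr (J (Q y n))).
by rewrite IP_mulKr midn IP_invM IP_mulVKl IP_mulKr.
Qed.

Lemma IP_mid_nucleus_left n :
    (forall w z, Q (Q w n) z = Q w (Q n z)) ->
  forall x y, Q (Q n x) y = Q n (Q x y).
Proof.
move=> midn x y; apply: (@qop_injl (J (Q n x))).
by rewrite IP_mulKl -midn IP_invM IP_mulVKr IP_mulKl.
Qed.

End InverseProperty.

(** * Squares in C-loops *)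

Lemma bij_squareE (L : Type) (U : bij L) x : (U ^+ 2) x = U (U x).
Proof. by []. Qed.

Section CLoop.
Variables (L : Type) (Q : quasigroup L).
Hypothesis HQ : is_C_loop Q.

Lemma C_loop_alternative :
  (forall y z, Q y (Q y z) = Q (Q y y) z) /\
  (forall x y, Q (Q x y) y = Q x (Q y y)).
Proof.
case: HQ => -[e id_e] Claw; split=> [y z|x y].
  by have := Claw e y z; rewrite !(id_e _).1.
by have := Claw x y e; rewrite !(id_e _).2.
Qed.

(** If [y z = e], the C-law reads [x y = ((x y) y) z], where [x y] is
    arbitrary; if [x y = e], it reads [x (y w) = w] with [w = y z] arbitrary.
    The two one-sided inverses so obtained agree. *)
Lemma C_loop_IP : exists J, inverse_property Q J.
Proof.
case: HQ => -[e id_e] Claw.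
pose r y := ldiv Q y e; pose l y := rdiv Q e y.
have mulr y : Q y (r y) = e by apply/ldivP.
have mull y : Q (l y) y = e by apply/rdivP.
have rK x y : Q (Q y x) (r x) = y.
  have <- : Q (rdiv Q y x) x = y by apply/rdivP.
  by rewrite -Claw mulr (id_e _).2.
have lK x y : Q (l x) (Q x y) = y.
  have <- : Q x (ldiv Q x y) = y by apply/ldivP.
  by rewrite Claw mull (id_e _).1.
have lr y : l y = r y by rewrite -(lK y (r y)) mulr (id_e _).2.
by exists r; split=> // x y; rewrite -lr.
Qed.

Lemma C_loop_square_mid_nucleus x w z :
  Q (Q w (Q x x)) z = Q w (Q (Q x x) z).
Proof.
have [altl altr] := C_loop_alternative.
by case: HQ => _ Claw; rewrite -altr -Claw altl.
Qed.

Lemma C_loop_Ltrans2_autotopism x :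
  autotopism Q (Ltrans Q x ^+ 2, 1, Ltrans Q x ^+ 2).
Proof.
have [[J IP] [altl _]] := (C_loop_IP, C_loop_alternative).
move=> u v; rewrite !bij_squareE /= !altl.
exact: (IP_mid_nucleus_left IP (C_loop_square_mid_nucleus x)).
Qed.

Lemma C_loop_Rtrans2_autotopism x :
  autotopism Q (1, Rtrans Q x ^+ 2, Rtrans Q x ^+ 2).
Proof.
have [[J IP] [_ altr]] := (C_loop_IP, C_loop_alternative).
move=> u v; rewrite !bij_squareE /= !altr.
by rewrite (IP_mid_nucleus_right IP (C_loop_square_mid_nucleus x)).
Qed.

End CLoop.

(** * Involutive translations and parastrophes *)

Section Parastrophes.
Variables (L : Type) (Q : quasigroup L).

Lemma bij_square_eq1 (U : bij L) : U ^+ 2 = 1 <-> involutive U.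
Proof.
split=> [UU z|Uinv]; first by rewrite -bij_squareE UU.
by apply: bijP => z; rewrite bij_squareE Uinv.
Qed.

Lemma par_invr_eqP :
  equal_groupoids (par_invr Q) Q <-> forall x, Ltrans Q x ^+ 2 = 1.
Proof.
split=> [eqQ x|sqL x z].
  by apply/bij_square_eq1 => z; apply/(par_invrP Q x (Q x z) z)/eqQ.
apply/par_invrP; exact: (bij_square_eq1 _).1 (sqL x) z.
Qed.

Lemma par_invl_eqP :
  equal_groupoids (par_invl Q) Q <-> forall y, Rtrans Q y ^+ 2 = 1.
Proof.
split=> [eqQ y|sqR z y].
  by apply/bij_square_eq1 => z; apply/(par_invlP Q (Q z y) y z)/eqQ.
apply/par_invlP; exact: (bij_square_eq1 _).1 (sqR y) z.
Qed.

(** With [z = x y], the involutions give [x z = y], then [y z = x], then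
    [y x = z]: the exchange of [x] and [y] is a product of the two other
    transpositions of letters. *)
Lemma involutive_translations_comm :
    (forall x y, Q x (Q x y) = y) -> (forall x y, Q (Q y x) x = y) ->
  commutative Q.
Proof.
move=> invL invR x y; set z := Q x y.
have yz : Q y z = x by rewrite -{1}(invL x y) invR.
by rewrite -yz invL.
Qed.

Lemma par_star_eq (P : quasigroup L) :
    equal_groupoids P Q -> commutative Q -> equal_groupoids (par_star P) Q.
Proof. by move=> eqPQ Qcomm x y; rewrite [LHS]eqPQ Qcomm. Qed.

End Parastrophes.

Lemma invgM_eq1 (G : groupType) (a u : G) : (a * u)^-1 * a = 1 <-> u = 1.
Proof.
rewrite invgM -mulgA mulVg mulg1.
by split=> [u1|->]; rewrite ?invg1 // -[u]invgK u1 invg1.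
Qed.

Theorem theorem3p1 (L : Type) (Q : quasigroup L) (HQ : is_C_loop Q)
    (A B C : bij L) (HABC : autotopism Q (A, B, C)) :
  let t1 (x : L) : bij L * bij L * bij L :=
    (A, B, C) * (Ltrans Q x ^+ 2, 1, Ltrans Q x ^+ 2) in
  let t2 (x : L) : bij L * bij L * bij L :=
    (A, B, C) * (1, Rtrans Q x ^+ 2, Rtrans Q x ^+ 2) in
  [/\ forall x : L,
        [/\ autotopism Q (t1 x), autotopism Q (t2 x),
            autotopism Q ((t1 x)^-1 * t2 x) &
            autotopism Q ((t2 x)^-1 * t1 x)],
      (equal_groupoids (par_invr Q) Q /\ equal_groupoids (par_invl Q) Q) <->
      (forall x : L, ((t1 x)^-1 * t2 x).1.1 = 1 /\
                     ((t2 x)^-1 * t1 x).1.2 = 1)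
    & equal_groupoids (par_invr Q) Q /\ equal_groupoids (par_invl Q) Q ->
      [/\ equal_groupoids (par_star Q) Q,
          equal_groupoids (par_invr_star Q) Q &
          equal_groupoids (par_invl_star Q) Q]].
Proof.
move=> t1 t2.
have aut1 x : autotopism Q (t1 x).
  exact: autotopismM HABC (C_loop_Ltrans2_autotopism HQ x).
have aut2 x : autotopism Q (t2 x).
  exact: autotopismM HABC (C_loop_Rtrans2_autotopism HQ x).
have comp1 x : ((t1 x)^-1 * t2 x).1.1 = 1 <-> Ltrans Q x ^+ 2 = 1.
  have -> : ((t1 x)^-1 * t2 x).1.1 = (A * Ltrans Q x ^+ 2)^-1 * (A * 1) by [].
  by rewrite mulg1; exact: invgM_eq1.
have comp2 x : ((t2 x)^-1 * t1 x).1.2 = 1 <-> Rtrans Q x ^+ 2 = 1.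
  have -> : ((t2 x)^-1 * t1 x).1.2 = (B * Rtrans Q x ^+ 2)^-1 * (B * 1) by [].
  by rewrite mulg1; exact: invgM_eq1.
split=> [x||[eqr eql]].
- by split=> //; apply: autotopismM => //; apply: autotopismV.
- split=> [[/par_invr_eqP sqL /par_invl_eqP sqR] x|sq].
    by split; [apply/comp1 | apply/comp2].
  split; first by apply/par_invr_eqP => x; apply/comp1; case: (sq x).
  by apply/par_invl_eqP => x; apply/comp2; case: (sq x).
- have Qcomm : commutative Q.
    apply: involutive_translations_comm => x y.
      by have /par_invr_eqP/(_ x)/bij_square_eq1/(_ y) := eqr.
    by have /par_invl_eqP/(_ x)/bij_square_eq1/(_ y) := eql.
  by split; apply: par_star_eq.
Qed.
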